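(* Let $\mathbb{O}$ denote the real octonions and let $$\mathcal{A}=\begin{pmatrix} d & a & \overline{b}\\ \overline{a} & e & c\\ b & \overline{c} & f\end{pmatrix},\qquad d,e,f\in\mathbb{R},\quad a,b,c\in\mathbb{O},$$ be a $3\times 3$ octonionic Hermitian matrix such that $\alpha:=(ab)c-a(bc)\neq 0$. Let $K:\mathbb{O}^3\to\mathbb{O}^3$ be the characteristic operator of $\mathcal{A}$, $$K[x]=\mathcal{A}\big(\mathcal{A}(\mathcal{A}x)\big)-(\operatorname{tr}\mathcal{A})\,\mathcal{A}(\mathcal{A}x)+\sigma(\mathcal{A})\,\mathcal{A}x-(\det\mathcal{A})\,x .$$ Let $y,z\in\mathbb{O}^3$ and suppose $K[y]=ry$ and $K[z]=rz$ with $r\in\mathbb{R}$. Then $$(yy^\dagger)\big((yy^\dagger)z\big)=(y^\dagger y)\big((yy^\dagger)z\big).$$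
   Context: $\mathbb{O}$ is the 8-dimensional real division algebra of octonions (nonassociative, alternative), with conjugation $p\mapsto\overline{p}$, real part $\operatorname{Re}(p)=\tfrac12(p+\overline p)$ and norm $|p|^2=p\overline p$. Vectors in $\mathbb{O}^3$ are column vectors; $y^\dagger$ is the conjugate transpose (a row vector); matrix products and matrix-vector products are computed by the usual row-by-column rule, with the parentheses as written. Thus $yy^\dagger$ is the $3\times3$ Hermitian matrix with entries $y_i\overline{y_j}$, and $y^\dagger y=\sum_i|y_i|^2\in\mathbb{R}$. For the matrix $\mathcal{A}$ displayed in the claim, $\operatorname{tr}\mathcal{A}=d+e+f$, $\sigma(\mathcal{A})=\tfrac12\big((\operatorname{tr}\mathcal{A})^2-\operatorname{tr}(\mathcal{A}^2)\big)$, and $\det\mathcal{A}$ is the Freudenthal determinant $$\det\mathcal{A}=def+2\operatorname{Re}\big(b(ac)\big)-d|c|^2-e|b|^2-f|a|^2 .$$ *)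

(* Defs.v *)
From HB Require Import structures.
From mathcomp Require Import all_boot all_order all_algebra.
From mathcomp Require Import ring.

Set Implicit Arguments.
Unset Strict Implicit.
Unset Printing Implicit Defensive.

Import GRing.Theory Num.Theory.
Local Open Scope ring_scope.

(* A record rather than a pair: A * A already carries a componentwise (hence
   associative) ring structure in MathComp, which must not be confused with the
   Cayley-Dickson product. *)
Record double (A : Type) := Double { dfst : A; dsnd : A }.

Definition double_pair (A : Type) (p : double A) := (dfst p, dsnd p).
Definition pair_double (A : Type) (p : A * A) := Double p.1 p.2.

Lemma double_pairK (A : Type) : cancel (@double_pair A) (@pair_double A).
Proof. by case. Qed.

HB.instance Definition _ (A : eqType) :=
  Equality.copy (double A) (can_type (@double_pairK A)).
HB.instance Definition _ (A : choiceType) :=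
  Choice.copy (double A) (can_type (@double_pairK A)).

Section DoubleZmodule.
Variable A : zmodType.
Implicit Types p q s : double A.

Definition double_zero : double A := Double 0 0.
Definition double_opp p := Double (- dfst p) (- dsnd p).
Definition double_add p q := Double (dfst p + dfst q) (dsnd p + dsnd q).

Lemma double_addA : associative double_add.
Proof. by case=> ? ? [? ?] [? ?]; congr Double; rewrite /= addrA. Qed.

Lemma double_addC : commutative double_add.
Proof. by case=> ? ? [? ?]; congr Double; rewrite /= addrC. Qed.

Lemma double_add0 : left_id double_zero double_add.
Proof. by case=> ? ?; congr Double; rewrite /= add0r. Qed.

Lemma double_addN : left_inverse double_zero double_opp double_add.
Proof. by case=> ? ?; congr Double; rewrite /= addNr. Qed.

HB.instance Definition _ := GRing.isZmodule.Build (double A)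
  double_addA double_addC double_add0 double_addN.

End DoubleZmodule.

Section DoubleLmodule.
Variables (R : pzRingType) (A : lmodType R).
Implicit Types p q : double A.

Definition double_scale (k : R) p := Double (k *: dfst p) (k *: dsnd p).

Lemma double_scaleA k l p :
  double_scale k (double_scale l p) = double_scale (k * l) p.
Proof. by congr Double; rewrite /= scalerA. Qed.

Lemma double_scale1 : left_id 1 double_scale.
Proof. by case=> ? ?; congr Double; rewrite /= scale1r. Qed.

Lemma double_scaleDr : right_distributive double_scale +%R.
Proof. by move=> k p q; congr Double; rewrite /= scalerDr. Qed.

Lemma double_scaleDl p :
  {morph double_scale^~ p : k l / k + l}.
Proof. by move=> k l; congr Double; rewrite /= scalerDl. Qed.

HB.instance Definition _ := GRing.Zmodule_isLmodule.Build R (double A)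
  double_scaleA double_scale1 double_scaleDr double_scaleDl.

End DoubleLmodule.

(* Cayley-Dickson doubling: with p = (p1, p2) standing for p1 + p2 l,
     (p1, p2) (q1, q2) = (p1 q1 - q2^* p2, q2 p1 + p2 q1^* ),
     (p1, p2)^* = (p1^*, - p2).                                              *)
Definition cd_mul (A : zmodType) (mul : A -> A -> A) (conj : A -> A)
    (p q : double A) : double A :=
  Double (mul (dfst p) (dfst q) - mul (conj (dsnd q)) (dsnd p))
         (mul (dsnd q) (dfst p) + mul (dsnd p) (conj (dfst q))).

Definition cd_conj (A : zmodType) (conj : A -> A) (p : double A) : double A :=
  Double (conj (dfst p)) (- dsnd p).

Section Octonion.
Variable R : realFieldType.

Definition octonion : Type := double (double (double R^o)).
HB.instance Definition _ := GRing.Lmodule.on octonion.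

Definition cconj : double R^o -> double R^o := cd_conj id.
Definition cmul : double R^o -> double R^o -> double R^o := cd_mul *%R id.
Definition qconj : double (double R^o) -> double (double R^o) := cd_conj cconj.
Definition qmul : double (double R^o) -> double (double R^o) ->
  double (double R^o) := cd_mul cmul cconj.
Definition oconj : octonion -> octonion := cd_conj qconj.
Definition omul : octonion -> octonion -> octonion := cd_mul qmul qconj.

Definition oreal (k : R) : octonion := Double (Double (Double k 0) 0) 0.

(* The real coordinate; oreal_oRe below is the formula Re p = (p + p^* ) / 2. *)
Definition oRe (p : octonion) : R := dfst (dfst (dfst p)).

Definition onormsq (p : octonion) : R := oRe (omul p (oconj p)).

End Octonion.

Notation "p *o q" := (omul p q) (at level 40, left associativity).

Section OctonionTheory.
Variable R : realFieldType.
Implicit Types (k : R) (p q : octonion R).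

Let ext p q :
  [/\ [/\ dfst (dfst (dfst p)) = dfst (dfst (dfst q)),
          dsnd (dfst (dfst p)) = dsnd (dfst (dfst q)),
          dfst (dsnd (dfst p)) = dfst (dsnd (dfst q)) &
          dsnd (dsnd (dfst p)) = dsnd (dsnd (dfst q))] &
      [/\ dfst (dfst (dsnd p)) = dfst (dfst (dsnd q)),
          dsnd (dfst (dsnd p)) = dsnd (dfst (dsnd q)),
          dfst (dsnd (dsnd p)) = dfst (dsnd (dsnd q)) &
          dsnd (dsnd (dsnd p)) = dsnd (dsnd (dsnd q))]] -> p = q.
Proof.
case: p q => [[[? ?] [? ?]] [[? ?] [? ?]]] [[[? ?] [? ?]] [[? ?] [? ?]]] /=.
by case=> -[-> -> -> ->] [-> -> -> ->].
Qed.

Let scaleRE k (x : R^o) : k *: x = (k : R^o) * x. Proof. by []. Qed.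

Lemma oreal_oRe p : oreal (oRe p) = 2^-1 *: (p + oconj p).
Proof.
case: p => [[[x0 x1] [x2 x3]] [[x4 x5] [x6 x7]]].
by apply: ext; do !split; rewrite /oRe /= scaleRE; field.
Qed.

Lemma omul_oreal k p : oreal k *o p = k *: p.
Proof.
case: p => [[[x0 x1] [x2 x3]] [[x4 x5] [x6 x7]]].
by apply: ext; do !split; rewrite /= scaleRE; ring.
Qed.

Lemma omul_altl p q : p *o (p *o q) = (p *o p) *o q.
Proof.
case: p q => [[[x0 x1] [x2 x3]] [[x4 x5] [x6 x7]]].
case=> [[[y0 y1] [y2 y3]] [[y4 y5] [y6 y7]]].
by apply: ext; do !split; rewrite /=; ring.
Qed.

Lemma omul_altr p q : (q *o p) *o p = q *o (p *o p).
Proof.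
case: p q => [[[x0 x1] [x2 x3]] [[x4 x5] [x6 x7]]].
case=> [[[y0 y1] [y2 y3]] [[y4 y5] [y6 y7]]].
by apply: ext; do !split; rewrite /=; ring.
Qed.

Lemma oconjM p q : oconj (p *o q) = oconj q *o oconj p.
Proof.
case: p q => [[[x0 x1] [x2 x3]] [[x4 x5] [x6 x7]]].
case=> [[[y0 y1] [y2 y3]] [[y4 y5] [y6 y7]]].
by apply: ext; do !split; rewrite /=; ring.
Qed.

Lemma omul_conj p : p *o oconj p = oreal (onormsq p).
Proof.
case: p => [[[x0 x1] [x2 x3]] [[x4 x5] [x6 x7]]].
by apply: ext; do !split; rewrite /onormsq /oRe /=; ring.
Qed.

Lemma onormsqM p q : onormsq (p *o q) = onormsq p * onormsq q.
Proof.
case: p q => [[[x0 x1] [x2 x3]] [[x4 x5] [x6 x7]]].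
case=> [[[y0 y1] [y2 y3]] [[y4 y5] [y6 y7]]].
by rewrite /onormsq /oRe /=; ring.
Qed.

End OctonionTheory.

Section OctonionMatrix.
Variable R : realFieldType.

(* MathComp's mulmx and scalemx need an associative (semi)ring of
   entries; only the additive structure of 'M[octonion R]_(m, n) is reused. *)
Definition omulmx (m n p : nat) (A : 'M[octonion R]_(m, n))
    (B : 'M[octonion R]_(n, p)) : 'M[octonion R]_(m, p) :=
  \matrix_(i, k) \sum_j (A i j *o B j k).

Definition oscalemx (m n : nat) (k : R) (A : 'M[octonion R]_(m, n)) :
  'M[octonion R]_(m, n) := map_mx ( *:%R k) A.

Definition dagger (m n : nat) (A : 'M[octonion R]_(m, n)) :
  'M[octonion R]_(n, m) := (map_mx (@oconj R) A)^T.

(* The sum of the diagonal entries, read in R; this loses nothing for Hermitian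
   matrices and their squares, see trace_hermitian and trace_hermitian_sqr. *)
Definition otrace (n : nat) (A : 'M[octonion R]_n) : R := oRe (\tr A).

(* The real number y^dagger y, see dagger_mul. *)
Definition vnormsq (n : nat) (y : 'cV[octonion R]_n) : R :=
  \sum_i onormsq (y i 0).

End OctonionMatrix.

Notation "A *mo B" := (omulmx A B) (at level 40, left associativity).
Notation "k *:o A" := (oscalemx k A) (at level 40).

Section Characteristic.
Variable R : realFieldType.
Implicit Types (d e f : R) (a b c : octonion R).

Definition hermitian3 d e f a b c : 'M[octonion R]_3 :=
  \matrix_(i, j) nth 0 (nth [::]
    [:: [:: oreal d; a;       oconj b];
        [:: oconj a; oreal e; c      ];
        [:: b;       oconj c; oreal f]] i) j.

Definition sigma (A : 'M[octonion R]_3) : R :=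
  2^-1 * (otrace A ^+ 2 - otrace (A *mo A)).

Definition freudenthal_det d e f a b c : R :=
  d * e * f + 2 * oRe (b *o (a *o c))
  - d * onormsq c - e * onormsq b - f * onormsq a.

Definition char_op d e f a b c (x : 'cV[octonion R]_3) : 'cV[octonion R]_3 :=
  let A := hermitian3 d e f a b c in
  A *mo (A *mo (A *mo x)) - otrace A *:o (A *mo (A *mo x))
  + sigma A *:o (A *mo x) - freudenthal_det d e f a b c *:o x.

End Characteristic.

Section MatrixTheory.
Variable R : realFieldType.
Implicit Types (d e f : R) (a b c p : octonion R).

Let orealD (k l : R) : oreal k + oreal l = oreal (k + l).
Proof. by congr Double; congr Double; congr Double; rewrite /= addr0. Qed.

Let oreal_sum (I : finType) (F : I -> R) :
  \sum_i oreal (F i) = oreal (\sum_i F i).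
Proof. by rewrite (big_morph (@oreal R) (fun x y => esym (orealD x y)) erefl). Qed.

Let oconjK p : oconj (oconj p) = p.
Proof.
case: p => [[[x0 x1] [x2 x3]] [[x4 x5] [x6 x7]]].
by rewrite /oconj /qconj /cconj /cd_conj /= !opprK.
Qed.

Let oconj_mul p : oconj p *o p = oreal (onormsq p).
Proof.
rewrite -{2}[p]oconjK omul_conj; congr oreal.
case: p => [[[x0 x1] [x2 x3]] [[x4 x5] [x6 x7]]].
by rewrite /onormsq /oRe /=; ring.
Qed.

Lemma dagger_hermitian3 d e f a b c :
  dagger (hermitian3 d e f a b c) = hermitian3 d e f a b c.
Proof.
have oconj_real k : oconj (oreal k) = oreal k :> octonion R.
  by rewrite /oconj /qconj /cconj /cd_conj /oreal /= !oppr0.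
apply/matrixP=> i j; rewrite !mxE.
by case: i j => [[|[|[|?]]] ?] [[|[|[|?]]] ?] //=; rewrite ?oconjK ?oconj_real.
Qed.

Lemma dagger_mul n (y : 'cV[octonion R]_n) :
  dagger y *mo y = const_mx (oreal (vnormsq y)).
Proof.
apply/matrixP=> i j; rewrite !mxE !ord1 -oreal_sum.
by apply: eq_bigr => k _; rewrite !mxE oconj_mul.
Qed.

Lemma trace_hermitian d e f a b c :
  \tr (hermitian3 d e f a b c) = oreal (d + e + f).
Proof. by rewrite /mxtrace !big_ord_recl big_ord0 !mxE /= addr0 !orealD addrA. Qed.

Lemma otrace_hermitian d e f a b c :
  otrace (hermitian3 d e f a b c) = d + e + f.
Proof. by rewrite /otrace trace_hermitian. Qed.

Lemma trace_hermitian_sqr d e f a b c :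
  let A := hermitian3 d e f a b c in
  \tr (A *mo A) = oreal (otrace (A *mo A)).
Proof.
move: (hermitian3 _ _ _ _ _ _) (dagger_hermitian3 d e f a b c) => A AT /=.
have AC i j : A j i = oconj (A i j) by rewrite -[in LHS]AT /dagger !mxE.
suff E : \tr (A *mo A) = oreal (\sum_i \sum_j onormsq (A i j)).
  by rewrite /otrace E.
rewrite -oreal_sum; apply: eq_bigr => i _; rewrite mxE -oreal_sum.
by apply: eq_bigr => j _; rewrite (AC i j) omul_conj.
Qed.

End MatrixTheory.

(* Main.v *)
(* The associativity defects in A(A(Ax)) leave K block diagonal and independent
   of d, e, f: on the first coordinate it is
   x |-> a(c(bx)) + b^*(c^*(a^* x)) - 2 Re(b(ac)) x, with the cyclic analogues
   on the other two.  Write a = a0 + i, b = b0 + b1 i + j and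
   c = c0 + c1 i + c2 j + k with i, j, k imaginary and orthogonal; they are
   nonzero because the associator of a, b, c is that of i, j, k.  Left
   multiplications by i, j, k anticommute, so the three blocks are one and the
   same operator, a scalar minus 2 i(j(k _)), and all coordinates of y and z lie
   in one eigenspace V of i(j(k _)), with nonzero eigenvalue unless V = 0.  Let
   D = span(1, i, j, k).  Left multiplication by an octonion orthogonal to D
   anticommutes with i(j(k _)), hence maps V into its orthogonal; therefore
   x y^* lies in D for x, y in V.  On V a product of two left multiplications by
   elements of D is again a left multiplication, and with
   (py)(y^* q) = (p(qy))y^* this gives (x y^* )((y w^* )z) = |y|^2 (x w^* )z for
   x, y, w, z in V, which is the claim term by term. *)
Require Import Defs.
From mathcomp Require Import all_boot all_order all_algebra.
From mathcomp Require Import reals.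
From mathcomp Require Import ring.

Set Implicit Arguments.
Unset Strict Implicit.
Unset Printing Implicit Defensive.

Import GRing.Theory Num.Theory.
Local Open Scope ring_scope.

(** * Separating octonions by linear functionals *)

Section OctonionCoordinates.
Variable R : realFieldType.
Implicit Types (k l : R) (p q g x y z w : octonion R).

Lemma octonion_ext p q :
  dfst (dfst (dfst p)) = dfst (dfst (dfst q)) ->
  dsnd (dfst (dfst p)) = dsnd (dfst (dfst q)) ->
  dfst (dsnd (dfst p)) = dfst (dsnd (dfst q)) ->
  dsnd (dsnd (dfst p)) = dsnd (dsnd (dfst q)) ->
  dfst (dfst (dsnd p)) = dfst (dfst (dsnd q)) ->
  dsnd (dfst (dsnd p)) = dsnd (dfst (dsnd q)) ->
  dfst (dsnd (dsnd p)) = dfst (dsnd (dsnd q)) ->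
  dsnd (dsnd (dsnd p)) = dsnd (dsnd (dsnd q)) -> p = q.
Proof.
case: p q => [[[? ?] [? ?]] [[? ?] [? ?]]] [[[? ?] [? ?]] [[? ?] [? ?]]] /=.
by do 8 move=> ->.
Qed.

(** The eight coordinates are such functionals. In this form an identity of vectors reduces to
    scalar arithmetic with octonion products as atoms. *)
Lemma octonion_linear_ext p q :
  (forall phi : octonion R -> R,
     {morph phi : u v / u + v} -> {morph phi : u / - u} ->
     (forall k, {morph phi : u / k *: u >-> k * u}) -> phi 0 = 0 ->
     phi p = phi q) ->
  p = q.
Proof. by move=> E; apply: octonion_ext; apply: (E (fun u => _)). Qed.

End OctonionCoordinates.

Ltac coords :=
  repeat match goal with p : octonion _ |- _ =>
    destruct p as [[[? ?] [? ?]] [[? ?] [? ?]]] end.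

Ltac coordwise :=
  coords; apply: octonion_ext;
  rewrite /onormsq /oRe /= /GRing.scale /=; ring.

(** * Octonion identities checked in coordinates *)

Section OctonionAlgebra.
Variable R : realFieldType.
Implicit Types (k l : R) (p q g x y z w : octonion R).

Lemma omulDl p q x : (p + q) *o x = p *o x + q *o x.
Proof. coordwise. Qed.
Lemma omulDr p x y : p *o (x + y) = p *o x + p *o y.
Proof. coordwise. Qed.
Lemma omulZl k p x : (k *: p) *o x = k *: (p *o x).
Proof. coordwise. Qed.
Lemma omulZr k p x : p *o (k *: x) = k *: (p *o x).
Proof. coordwise. Qed.
Lemma omul0 p : p *o 0 = 0.
Proof. coordwise. Qed.
Lemma omul_oreal_r k p : p *o oreal k = k *: p.
Proof. coordwise. Qed.
Lemma oconjD p q : oconj (p + q) = oconj p + oconj q.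
Proof. coordwise. Qed.
Lemma oconjZ k p : oconj (k *: p) = k *: oconj p.
Proof. coordwise. Qed.
Lemma oconj_oreal k : oconj (oreal k) = oreal k :> octonion R.
Proof. coordwise. Qed.

(** The Euclidean inner product; [oinner p p] and [onormsq p] agree by unfolding, so identities for
    [onormsq] serve directly as laws for this form. *)
Definition oinner p q : R := oRe (p *o oconj q).

Lemma omul_conjl p x : oconj p *o (p *o x) = onormsq p *: x.
Proof. coordwise. Qed.
Lemma omul_conjr p x : p *o (oconj p *o x) = onormsq p *: x.
Proof. coordwise. Qed.
Lemma omulK_conj x y : (x *o y) *o oconj y = onormsq y *: x.
Proof. coordwise. Qed.
Lemma omulKC_conj x y : (x *o oconj y) *o y = onormsq y *: x.
Proof. coordwise. Qed.
Lemma omul_polar p q x :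
  p *o (oconj q *o x) + q *o (oconj p *o x) = (2 * oinner p q) *: x.
Proof. rewrite /oinner; coordwise. Qed.
Lemma oinner_adj p x y : oinner (p *o x) y = oinner x (oconj p *o y).
Proof. by rewrite /oinner; coords; rewrite /oRe /=; ring. Qed.
Lemma oinner_mulr g x y : oinner x (g *o y) = oinner (x *o oconj y) g.
Proof. by rewrite /oinner; coords; rewrite /oRe /=; ring. Qed.
Lemma oinnerC x y : oinner x y = oinner y x.
Proof. by rewrite /oinner; coords; rewrite /oRe /=; ring. Qed.
Lemma oinnerDl x y z : oinner (x + y) z = oinner x z + oinner y z.
Proof. by rewrite /oinner; coords; rewrite /oRe /=; ring. Qed.
Lemma oinnerZl k x z : oinner (k *: x) z = k * oinner x z.
Proof. by rewrite /oinner; coords; rewrite /oRe /= /GRing.scale /=; ring. Qed.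

(** A Moufang identity: for nonzero [y] it amounts to ((py)(y^-1 q))y = p(qy). *)
Lemma omul_sandwich p q y :
  (p *o y) *o (oconj y *o q) = (p *o (q *o y)) *o oconj y.
Proof. coordwise. Qed.

Lemma onormsq_eq0 p : (onormsq p == 0) = (p == 0).
Proof.
apply/eqP/eqP => [|->]; last by rewrite /onormsq /oRe /=; ring.
case: p => [[[p0 p1] [p2 p3]] [[p4 p5] [p6 p7]]].
have -> : onormsq (Double (Double (Double p0 p1) (Double p2 p3))
      (Double (Double p4 p5) (Double p6 p7))) =
    p0 ^+ 2 + p1 ^+ 2 + p2 ^+ 2 + p3 ^+ 2 +
    p4 ^+ 2 + p5 ^+ 2 + p6 ^+ 2 + p7 ^+ 2.
  by rewrite /onormsq /oRe /=; ring.
move/eqP; rewrite !paddr_eq0 ?addr_ge0 ?sqr_ge0 // !sqrf_eq0 -!andbA.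
by do 7 case/andP=> /eqP ->; move=> /eqP ->.
Qed.

Lemma oreal1_mul p : oreal 1 *o p = p.
Proof. by rewrite omul_oreal scale1r. Qed.
Lemma omul_oreal1 p : p *o oreal 1 = p.
Proof. by rewrite omul_oreal_r scale1r. Qed.
Lemma omul_flex p x : (p *o x) *o p = p *o (x *o p).
Proof. coordwise. Qed.
Lemma add_oconj1 p : p + oconj p = (2 * oinner p (oreal 1)) *: oreal 1.
Proof. rewrite /oinner; coordwise. Qed.
Lemma oinner_eq0 p : oinner p p = 0 -> p = 0.
Proof. by move/eqP; rewrite onormsq_eq0 => /eqP. Qed.
Lemma oReD p q : oRe (p + q) = oRe p + oRe q.
Proof. by []. Qed.
Lemma oRe_oreal2 k l : oRe (oreal k *o oreal l : octonion R) = k * l.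
Proof. by rewrite /oRe /=; ring. Qed.
Lemma oRe_mul_conj p : oRe (p *o oconj p) = onormsq p.
Proof. by []. Qed.
Lemma oRe_conj_mul p : oRe (oconj p *o p) = onormsq p.
Proof. by coords; rewrite /onormsq /oRe /=; ring. Qed.
End OctonionAlgebra.

(* The argument is carried out over the laws below rather than on [octonion]
   itself, where unification unfolds the Cayley-Dickson addition and rewriting
   becomes intractable. *)
Record octonion_laws (R : realFieldType) := OctonionLaws {
  carrier :> lmodType R;
  amul : carrier -> carrier -> carrier;
  aconj : carrier -> carrier;
  aone : carrier;
  ainner : carrier -> carrier -> R;
  alinear_ext : forall p q,
    (forall phi : carrier -> R,
       {morph phi : u v / u + v} -> {morph phi : u / - u} ->
       (forall k, {morph phi : u / k *: u >-> k * u}) -> phi 0 = 0 ->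
       phi p = phi q) -> p = q;
  amulDl : forall p q x, amul (p + q) x = amul p x + amul q x;
  amulDr : forall p x y, amul p (x + y) = amul p x + amul p y;
  amulZl : forall k p x, amul (k *: p) x = k *: amul p x;
  amulZr : forall k p x, amul p (k *: x) = k *: amul p x;
  amul1l : forall x, amul aone x = x;
  amul1r : forall x, amul x aone = x;
  amul_altl : forall p x, amul (amul p p) x = amul p (amul p x);
  amul_altr : forall p x, amul (amul x p) p = amul x (amul p p);
  amul_flex : forall p x, amul (amul p x) p = amul p (amul x p);
  aconjD : forall p q, aconj (p + q) = aconj p + aconj q;
  aconjZ : forall k p, aconj (k *: p) = k *: aconj p;
  aconj1 : aconj aone = aone;
  aconj_add : forall p, p + aconj p = (2 * ainner p aone) *: aone;
  ainnerDl : forall x y z, ainner (x + y) z = ainner x z + ainner y z;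
  ainnerZl : forall k x z, ainner (k *: x) z = k * ainner x z;
  ainnerC : forall x y, ainner x y = ainner y x;
  ainner_eq0 : forall x, ainner x x = 0 -> x = 0;
  ainner_adj : forall p x y, ainner (amul p x) y = ainner x (amul (aconj p) y);
  ainner_mulr : forall g x y,
    ainner x (amul g y) = ainner (amul x (aconj y)) g;
  aconj_mulK : forall p x, amul (aconj p) (amul p x) = ainner p p *: x;
  amul_conjK : forall p x, amul p (amul (aconj p) x) = ainner p p *: x;
  amul_polar : forall p q x, amul p (amul (aconj q) x)
    + amul q (amul (aconj p) x) = (2 * ainner p q) *: x;
  amulK_conj : forall x y, amul (amul x y) (aconj y) = ainner y y *: x;
  amul_conjrK : forall x y, amul (amul x (aconj y)) y = ainner y y *: x;
  amul_sandwich : forall p q y,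
    amul (amul p y) (amul (aconj y) q) = amul (amul p (amul q y)) (aconj y)
}.

Arguments amul {R o}.
Arguments aconj {R o}.
Arguments aone {R o}.
Arguments ainner {R o}.

Ltac linear_ring :=
  apply: alinear_ext;
  let phi := fresh in let phiD := fresh in let phiN := fresh in
  let phiZ := fresh in let phi0 := fresh in
  intros phi phiD phiN phiZ phi0; rewrite ?(phiD, phiN, phiZ, phi0); ring.

(** * Elementary consequences of the octonion laws *)

Section TripleProduct.
Variables (R : realFieldType) (O : octonion_laws R).
Implicit Types (p q g x y z w : O).
Local Notation "p ** q" := (amul p q) (at level 40, left associativity).
Local Notation one := (aone : O).
Local Notation norm p := (ainner p p).

Lemma amulNl p x : (- p) ** x = - (p ** x).
Proof. by rewrite -scaleN1r amulZl scaleN1r. Qed.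
Lemma amulNr p x : p ** (- x) = - (p ** x).
Proof. by rewrite -scaleN1r amulZr scaleN1r. Qed.
Lemma amul0l x : 0 ** x = 0.
Proof. by rewrite -(scale0r (0 : O)) amulZl !scale0r. Qed.
Lemma amul0r p : p ** 0 = 0.
Proof. by rewrite -(scale0r (0 : O)) amulZr !scale0r. Qed.
Lemma aconjBZ l x y : aconj (x - l *: y) = aconj x - l *: aconj y.
Proof. by rewrite aconjD -!scaleNr aconjZ. Qed.
Lemma ainnerNl x z : ainner (- x) z = - ainner x z.
Proof. by rewrite -scaleN1r ainnerZl mulN1r. Qed.
Lemma ainnerBZ l x y z : ainner (x - l *: y) z = ainner x z - l * ainner y z.
Proof. by rewrite ainnerDl ainnerNl ainnerZl. Qed.
Lemma ainner_neq0 p : p != 0 -> norm p != 0.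
Proof. by apply: contra_neq; apply: ainner_eq0. Qed.
Lemma ainner0l z : ainner 0 z = 0.
Proof. by rewrite -(scale0r (0 : O)) ainnerZl mul0r. Qed.
Lemma amul_eq0 p x : p != 0 -> p ** x = 0 -> x = 0.
Proof.
move=> /ainner_neq0 pN px0; apply: (scalerI pN).
by rewrite -aconj_mulK px0 amul0r scaler0.
Qed.

Lemma imag_sq g x : aconj g = - g -> g ** (g ** x) = - norm g *: x.
Proof. by move=> gI; rewrite scaleNr -aconj_mulK gI amulNl opprK. Qed.

Lemma imag_anticomm p q x : aconj p = - p -> aconj q = - q ->
  ainner p q = 0 -> p ** (q ** x) = - (q ** (p ** x)).
Proof.
move=> pI qI pq0; have := amul_polar p q x.
rewrite pI qI pq0 mulr0 scale0r !amulNl !amulNr -opprD => /eqP.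
by rewrite oppr_eq0 addr_eq0 => /eqP.
Qed.

Lemma imag_inner1 p : aconj p = - p -> ainner p one = 0.
Proof.
move=> pI; have := aconj_add p; rewrite pI subrr.
(* The laws admit the zero algebra, where [aone] is zero. *)
have [-> _|one0 /esym/eqP] := eqVneq one 0; first by rewrite ainnerC ainner0l.
rewrite scaler_eq0 (negPf one0) orbF mulf_eq0 pnatr_eq0 => /eqP //.
Qed.

Lemma imag_of_inner1 p : ainner p one = 0 -> aconj p = - p.
Proof.
move=> p1; have /eqP := aconj_add p.
by rewrite p1 mulr0 scale0r addrC addr_eq0 => /eqP.
Qed.

(** * Eigenspaces of i(j(k _)) for an orthogonal imaginary frame *)

Section Frame.
Variables (i j k : O) (mu : R).
Hypotheses (iI : aconj i = - i) (jI : aconj j = - j) (kI : aconj k = - k).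
Hypotheses (ij0 : ainner i j = 0) (ik0 : ainner i k = 0) (jk0 : ainner j k = 0).
Hypotheses (i0 : i != 0) (j0 : j != 0) (k0 : k != 0).

Let iN := ainner_neq0 i0.
Let jN := ainner_neq0 j0.
Let kN := ainner_neq0 k0.

Lemma frame_swap_ji x : j ** (i ** x) = - (i ** (j ** x)).
Proof. by apply: imag_anticomm => //; rewrite ainnerC. Qed.
Lemma frame_swap_ki x : k ** (i ** x) = - (i ** (k ** x)).
Proof. by apply: imag_anticomm => //; rewrite ainnerC. Qed.
Lemma frame_swap_kj x : k ** (j ** x) = - (j ** (k ** x)).
Proof. by apply: imag_anticomm => //; rewrite ainnerC. Qed.

Definition triple_eigen x := i ** (j ** (k ** x)) = mu *: x.

Definition in_frame p :=
  exists t0 t1 t2 t3, p = t0 *: aone + t1 *: i + t2 *: j + t3 *: k.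

(** Each left side is M + M^*, with M a product of three left multiplications. Among the sorted
    words in [i], [j], [k], those of length one and two are skew-adjoint and drop out; the scalar
    part and the word of length three are self-adjoint and double. The sign of the latter is
    negative because acb, cba and bac are odd permutations of abc. *)
Lemma frame_sandwich a0 b0 b1 c0 c1 c2 a b c x :
  a = a0 *: one + i -> b = b0 *: one + b1 *: i + j ->
  c = c0 *: one + c1 *: i + c2 *: j + k ->
  let l := 2 * (a0 * b0 * c0 - a0 * (b1 * c1 * norm i + c2 * norm j)
    - c0 * (b1 * norm i) - b0 * (c1 * norm i)) in
  [/\ a ** (c ** (b ** x)) + aconj b ** (aconj c ** (aconj a ** x)) =
        l *: x - 2 *: (i ** (j ** (k ** x))),
      c ** (b ** (a ** x)) + aconj a ** (aconj b ** (aconj c ** x)) =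
        l *: x - 2 *: (i ** (j ** (k ** x))) &
      b ** (a ** (c ** x)) + aconj c ** (aconj a ** (aconj b ** x)) =
        l *: x - 2 *: (i ** (j ** (k ** x)))].
Proof.
move=> -> -> -> l; rewrite !(aconjD, aconjZ, aconj1) iI jI kI.
have isq x' : i ** (i ** x') = - norm i *: x' by apply: imag_sq.
have jsq x' : j ** (j ** x') = - norm j *: x' by apply: imag_sq.
have E := (amulDl, amulDr, amulZl, amulZr, amul1l, amulNl, amulNr,
  frame_swap_ji, frame_swap_ki, frame_swap_kj, isq, jsq).
by split; rewrite !E /l; linear_ring.
Qed.

(** Multiplying the eigenvalue equation by [k] and moving it inward makes two factors [k] meet and
    cancel. In the same way, on the eigenspace each product of two frame elements acts as a multiple
    of the third. *)
Lemma triple_eigen_ij x : triple_eigen x ->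
  i ** (j ** x) = - (mu / norm k) *: (k ** x).
Proof.
move=> xV; have : k ** (i ** (j ** (k ** x))) = mu *: (k ** x).
  by rewrite xV amulZr.
rewrite frame_swap_ki frame_swap_kj amulNr opprK imag_sq // !amulZr => E.
apply: (scalerI kN); rewrite scalerA mulrN mulrCA divff // mulr1 scaleNr -E.
by rewrite scaleNr opprK.
Qed.

Lemma triple_eigen_ik x : triple_eigen x ->
  i ** (k ** x) = (mu / norm j) *: (j ** x).
Proof.
move=> xV; have : j ** (i ** (j ** (k ** x))) = mu *: (j ** x).
  by rewrite xV amulZr.
rewrite frame_swap_ji imag_sq // !amulZr scaleNr opprK => E.
by apply: (scalerI jN); rewrite scalerA mulrCA divff // mulr1 -E.
Qed.

Lemma triple_eigen_jk x : triple_eigen x ->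
  j ** (k ** x) = - (mu / norm i) *: (i ** x).
Proof.
move=> xV; have : i ** (i ** (j ** (k ** x))) = mu *: (i ** x).
  by rewrite xV amulZr.
rewrite imag_sq // => E.
apply: (scalerI iN); rewrite scalerA mulrN mulrCA divff // mulr1 scaleNr -E.
by rewrite scaleNr opprK.
Qed.

(** The span of the frame need not be closed under multiplication; the product collapses only in its
    action on the eigenspace. Since [s] is chosen before [x], its action on two different
    eigenvectors can be compared. *)
Lemma frame_mul p q : in_frame p -> in_frame q ->
  exists s, forall x, triple_eigen x -> p ** (q ** x) = s ** x.
Proof.
case=> p0 [p1 [p2 [p3 ->]]] [q0 [q1 [q2 [q3 ->]]]].
pose u := - (mu / norm k); pose v := mu / norm j; pose w := - (mu / norm i).
exists ((p0 * q0 - p1 * q1 * norm i - p2 * q2 * norm j - p3 * q3 * norm k)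
    *: one
  + (p0 * q1 + p1 * q0 + w * (p2 * q3 - p3 * q2)) *: i
  + (p0 * q2 + p2 * q0 + v * (p1 * q3 - p3 * q1)) *: j
  + (p0 * q3 + p3 * q0 + u * (p1 * q2 - p2 * q1)) *: k) => x xV.
rewrite !(amulDl, amulDr, amulZl, amulZr, amul1l).
rewrite frame_swap_ji frame_swap_ki frame_swap_kj !imag_sq //.
rewrite triple_eigen_ij // triple_eigen_ik // triple_eigen_jk // -/u -/v -/w.
linear_ring.
Qed.

(* Left multiplication by [g] anticommutes with [i(j(k _))], so it maps the
   eigenspace of [mu] into that of [- mu], and these are orthogonal. *)
Lemma triple_eigen_orth g x y : mu != 0 -> aconj g = - g ->
  ainner i g = 0 -> ainner j g = 0 -> ainner k g = 0 ->
  triple_eigen x -> triple_eigen y -> ainner x (g ** y) = 0.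
Proof.
move=> mu0 gI ig jg kg xV yV.
(* The reversed order is what appears once [i], [j], [k] are moved across the inner product. *)
have gyV : k ** (j ** (i ** (g ** y))) = mu *: (g ** y).
  rewrite (imag_anticomm _ iI gI ig) !amulNr (imag_anticomm _ jI gI jg).
  rewrite !amulNr (imag_anticomm _ kI gI kg) frame_swap_ji !amulNr.
  by rewrite frame_swap_ki frame_swap_kj !amulNr !opprK yV amulZr.
have : mu * ainner x (g ** y) = - (mu * ainner x (g ** y)).
  rewrite -{1}ainnerZl -xV !ainner_adj iI jI kI !amulNl !amulNr gyV.
  by rewrite !(ainnerC x) !ainnerNl ainnerZl !opprK.
move=> /eqP; rewrite -addr_eq0 -mulr2n mulrn_eq0 mulf_eq0 (negPf mu0) /=.
by move/eqP.
Qed.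

(** Subtract from p = x y^* its orthogonal projection onto the span. The remainder [g] is orthogonal
    to the frame, so |g|^2 = (p, g) = (x, g y) = 0. *)
Lemma triple_eigen_in_frame x y :
  triple_eigen x -> triple_eigen y -> in_frame (x ** aconj y).
Proof.
move=> xV yV; have [mu0|mu0] := eqVneq mu 0.
  have -> : x = 0.
    apply: (amul_eq0 k0); apply: (amul_eq0 j0); apply: (amul_eq0 i0).
    by rewrite xV mu0 scale0r.
  by exists 0, 0, 0, 0; rewrite !scale0r !addr0 amul0l.
set p := x ** aconj y.
have [one0|one0] := eqVneq one 0.
  exists 0, 0, 0, 0; rewrite -[p]amul1l one0 amul0l !scale0r.
  by rewrite !addr0.
have oneN := ainner_neq0 one0.
exists (ainner p one / norm one), (ainner p i / norm i),
  (ainner p j / norm j), (ainner p k / norm k).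
set s := _ + _; apply/eqP; rewrite -subr_eq0; apply/eqP.
apply: ainner_eq0; set g := p - s.
have [i1 j1 k1] : [/\ ainner i one = 0, ainner j one = 0 & ainner k one = 0].
  by split; apply: imag_inner1.
have g1 : ainner g one = 0.
  rewrite ainnerDl ainnerNl !ainnerDl !ainnerZl i1 j1 k1 divfK //; ring.
have gi : ainner g i = 0.
  rewrite ainnerDl ainnerNl !ainnerDl !ainnerZl (ainnerC one) (ainnerC j).
  rewrite (ainnerC k) i1 ij0 ik0 divfK //; ring.
have gj : ainner g j = 0.
  rewrite ainnerDl ainnerNl !ainnerDl !ainnerZl (ainnerC one) (ainnerC k).
  rewrite j1 ij0 jk0 divfK //; ring.
have gk : ainner g k = 0.
  rewrite ainnerDl ainnerNl !ainnerDl !ainnerZl (ainnerC one).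
  rewrite k1 ik0 jk0 divfK //; ring.
have sg : ainner s g = 0.
  rewrite !ainnerDl !ainnerZl !(ainnerC _ g) g1 gi gj gk; ring.
have gg : norm g = ainner p g by rewrite {1}/g ainnerDl ainnerNl sg subr0.
rewrite gg /p -ainner_mulr; apply: triple_eigen_orth => //.
- exact: imag_of_inner1.
- by rewrite ainnerC.
- by rewrite ainnerC.
- by rewrite ainnerC.
Qed.

(** Put p = x y^*, q = y w^*, and let [s] represent p(q _) on the eigenspace. Acting on [y], the
    Moufang law gives |y|^2 s = (p(qy))y^* = (py)(y^* q) = |y|^4 x w^*, which determines [s]; then
    let it act on [z]. *)
Lemma triple_eigen_assoc x y w z :
  triple_eigen x -> triple_eigen y -> triple_eigen w -> triple_eigen z ->
  (x ** aconj y) ** ((y ** aconj w) ** z) = norm y *: ((x ** aconj w) ** z).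
Proof.
move=> xV yV wV zV; have [->|/ainner_neq0 yN] := eqVneq y 0.
  by rewrite amul0l amul0l amul0r ainner0l scale0r.
have [s sE] := frame_mul (triple_eigen_in_frame xV yV)
  (triple_eigen_in_frame yV wV).
apply: (scalerI yN); apply: (scalerI yN).
rewrite sE //.
have -> : norm y *: (norm y *: (norm y *: (x ** aconj w ** z))) =
  norm y *: ((((x ** aconj y) ** y) ** (aconj y ** (y ** aconj w))) ** z).
  by rewrite amul_conjrK aconj_mulK !(amulZl, amulZr).
by rewrite amul_sandwich sE // amulK_conj amulZl.
Qed.
End Frame.

(** * From a nonassociating triple to a frame *)

(** The associator is trilinear and alternating and vanishes on [aone], so every other term of the
    expansion is zero. *)
Lemma assoc_frame (i j k : O) a0 b0 b1 c0 c1 c2 a b c :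
  a = a0 *: one + i -> b = b0 *: one + b1 *: i + j ->
  c = c0 *: one + c1 *: i + c2 *: j + k ->
  (a ** b) ** c - a ** (b ** c) = (i ** j) ** k - i ** (j ** k).
Proof.
move=> -> -> ->.
rewrite !(amulDl, amulDr, amulZl, amulZr, amul1l, amul1r).
rewrite !(amul_altl, amul_altr, amul_flex); linear_ring.
Qed.

(** Gram-Schmidt, without normalisation, on the imaginary parts of [a], [b], [c]. *)
Lemma exists_frame a b c : (a ** b) ** c - a ** (b ** c) != 0 ->
  exists i j k l,
    [/\ aconj i = - i, aconj j = - j & aconj k = - k] /\
    [/\ ainner i j = 0, ainner i k = 0 & ainner j k = 0] /\
    [/\ i != 0, j != 0 & k != 0] /\
    forall x,
    [/\ a ** (c ** (b ** x)) + aconj b ** (aconj c ** (aconj a ** x)) =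
          l *: x - 2 *: (i ** (j ** (k ** x))),
        c ** (b ** (a ** x)) + aconj a ** (aconj b ** (aconj c ** x)) =
          l *: x - 2 *: (i ** (j ** (k ** x))) &
        b ** (a ** (c ** x)) + aconj c ** (aconj a ** (aconj b ** x)) =
          l *: x - 2 *: (i ** (j ** (k ** x)))].
Proof.
move=> assoc0; pose im p := p - ainner p one *: one.
have imI p : aconj (im p) = - im p.
  have -> : aconj (im p) = (p + aconj p) - p - ainner p one *: one.
    by rewrite aconjBZ aconj1; linear_ring.
  by rewrite aconj_add; linear_ring.
pose i := im a; pose b1 := ainner (im b) i / norm i.
pose j := im b - b1 *: i; pose c1 := ainner (im c) i / norm i.
pose c2 := ainner (im c) j / norm j; pose k := im c - c1 *: i - c2 *: j.
have aE : a = ainner a one *: one + i by linear_ring.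
have bE : b = ainner b one *: one + b1 *: i + j.
  by rewrite /j /im; linear_ring.
have cE : c = ainner c one *: one + c1 *: i + c2 *: j + k.
  by rewrite /k /im; linear_ring.
(* The decompositions hold whatever [b1], [c1], [c2] are, so the associator shows [i], [j], [k]
   nonzero before orthogonality relies on dividing by their norms. *)
have := assoc0; rewrite (assoc_frame aE bE cE) => ijk0.
have i0 : i != 0 by apply: contra_neq ijk0 => ->; rewrite !amul0l subrr.
have j0 : j != 0.
  by apply: contra_neq ijk0 => ->; rewrite !(amul0l, amul0r) subrr.
have k0 : k != 0 by apply: contra_neq ijk0 => ->; rewrite !amul0r subrr.
have [iN jN] := (ainner_neq0 i0, ainner_neq0 j0).
have iI : aconj i = - i by apply: imI.
have jI : aconj j = - j.
  by rewrite /j aconjBZ imI iI; linear_ring.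
have kI : aconj k = - k.
  by rewrite /k 2!aconjBZ imI iI jI; linear_ring.
have ji0 : ainner j i = 0.
  by rewrite /j ainnerBZ divfK // subrr.
have ij0 : ainner i j = 0 by rewrite ainnerC.
have ik0 : ainner i k = 0.
  rewrite ainnerC /k 2!ainnerBZ ji0 divfK //; ring.
have jk0 : ainner j k = 0.
  rewrite ainnerC /k 2!ainnerBZ ij0 divfK //; ring.
exists i, j, k; eexists; do 3!split=> //.
by move=> x; apply: frame_sandwich aE bE cE.
Qed.

(** A disjunction, because the three blocks are one operator once the associator is nonzero;
    coordinates from different positions can then be mixed freely. *)
Definition sandwich_eigen a b c (s : R) x :=
  [\/ a ** (c ** (b ** x)) + aconj b ** (aconj c ** (aconj a ** x)) = s *: x,
      c ** (b ** (a ** x)) + aconj a ** (aconj b ** (aconj c ** x)) = s *: x |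
      b ** (a ** (c ** x)) + aconj c ** (aconj a ** (aconj b ** x)) = s *: x].

Lemma sandwich_eigen_assoc a b c s x y w z :
  (a ** b) ** c - a ** (b ** c) != 0 ->
  sandwich_eigen a b c s x -> sandwich_eigen a b c s y ->
  sandwich_eigen a b c s w -> sandwich_eigen a b c s z ->
  (x ** aconj y) ** ((y ** aconj w) ** z) = norm y *: ((x ** aconj w) ** z).
Proof.
move=> /exists_frame[i [j [k [l [[iI jI kI] [[ij ik jk] [[i0 j0 k0] E]]]]]]].
(* The eigenvalue solves l - 2 mu = s. *)
have eig v : sandwich_eigen a b c s v -> triple_eigen i j k ((l - s) / 2) v.
  have [E1 E2 E3] := E v => sv.
  have {sv} /(congr1 (fun u => 2^-1 *: (l *: v - u))) :
    l *: v - 2 *: (i ** (j ** (k ** v))) = s *: v.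
    by case: sv => <-.
  rewrite opprB addrC subrK scalerA mulVf ?pnatr_eq0 // scale1r /triple_eigen.
  move=> ->.
  by rewrite -scalerBl scalerA mulrC.
move=> /eig xV /eig yV /eig wV /eig zV.
by apply: triple_eigen_assoc xV yV wV zV.
Qed.

(** * The characteristic operator in coordinates *)

(** By alternativity every p^*(p x) becomes a norm, and the terms in [t] and [s] cancel all but one
    block plus the scalar [h] on each coordinate. [D] may be arbitrary, since it only shifts the
    eigenvalue. *)
Lemma char_op_sandwich d e f D r a b c x1 x2 x3 X1 X2 X3 Y1 Y2 Y3 Z1 Z2 Z3 :
  X1 = d *: x1 + a ** x2 + aconj b ** x3 ->
  X2 = aconj a ** x1 + e *: x2 + c ** x3 ->
  X3 = b ** x1 + aconj c ** x2 + f *: x3 ->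
  Y1 = d *: X1 + a ** X2 + aconj b ** X3 ->
  Y2 = aconj a ** X1 + e *: X2 + c ** X3 ->
  Y3 = b ** X1 + aconj c ** X2 + f *: X3 ->
  Z1 = d *: Y1 + a ** Y2 + aconj b ** Y3 ->
  Z2 = aconj a ** Y1 + e *: Y2 + c ** Y3 ->
  Z3 = b ** Y1 + aconj c ** Y2 + f *: Y3 ->
  let t := d + e + f in
  let s := d * e + e * f + f * d - norm a - norm b - norm c in
  let h := d * e * f - d * norm c - e * norm b - f * norm a - D in
  [/\ Z1 - t *: Y1 + s *: X1 - D *: x1 = r *: x1 ->
        sandwich_eigen a b c (r - h) x1,
      Z2 - t *: Y2 + s *: X2 - D *: x2 = r *: x2 ->
        sandwich_eigen a b c (r - h) x2 &
      Z3 - t *: Y3 + s *: X3 - D *: x3 = r *: x3 ->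
        sandwich_eigen a b c (r - h) x3].
Proof.
move=> -> -> -> -> -> -> -> -> -> t s h; rewrite /sandwich_eigen.
split=> E; [apply: Or31 | apply: Or32 | apply: Or33]; rewrite scalerBl -E;
  rewrite /t /s /h !(amulDr, amulZr, aconj_mulK, amul_conjK); linear_ring.
Qed.

End TripleProduct.

Definition octonion_has_laws (R : realFieldType) : octonion_laws R :=
  @OctonionLaws R (octonion R) (@omul R) (@oconj R) (oreal 1) (@oinner R)
    (@octonion_linear_ext R) (@omulDl R) (@omulDr R) (@omulZl R) (@omulZr R)
    (@oreal1_mul R) (@omul_oreal1 R) (fun p x => esym (omul_altl p x))
    (fun p x => omul_altr p x) (@omul_flex R) (@oconjD R) (@oconjZ R)
    (@oconj_oreal R 1) (@add_oconj1 R) (@oinnerDl R)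
    (@oinnerZl R) (@oinnerC R) (@oinner_eq0 R) (@oinner_adj R)
    (@oinner_mulr R) (@omul_conjl R) (@omul_conjr R) (@omul_polar R)
    (@omulK_conj R) (@omulKC_conj R) (@omul_sandwich R).

Lemma col_char_coord (R : pzRingType) (V : lmodType R) n (t s D r : R)
    (X Y Z v : 'cV[V]_n) i :
  Z - map_mx ( *:%R t) Y + map_mx ( *:%R s) X - map_mx ( *:%R D) v
    = map_mx ( *:%R r) v ->
  Z i 0 - t *: Y i 0 + s *: X i 0 - D *: v i 0 = r *: v i 0.
Proof. by move/matrixP/(_ i 0); rewrite !mxE. Qed.

Section CharacteristicOperator.
Variables (R : realFieldType) (d e f : R) (a b c : octonion R).
Local Notation A := (hermitian3 d e f a b c).
Local Notation i1 := (lift ord0 ord0 : 'I_3).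
Local Notation i2 := (lift ord0 (lift ord0 ord0) : 'I_3).

Lemma hermitian3_mul (v : 'cV[octonion R]_3) :
  [/\ (A *mo v) ord0 0 =
        d *: v ord0 0 + a *o v i1 0 + oconj b *o v i2 0,
      (A *mo v) i1 0 =
        oconj a *o v ord0 0 + e *: v i1 0 + c *o v i2 0 &
      (A *mo v) i2 0 =
        b *o v ord0 0 + oconj c *o v i1 0 + f *: v i2 0].
Proof.
by split; rewrite mxE !big_ord_recl big_ord0 !mxE addr0 addrA omul_oreal.
Qed.

Lemma sigma_hermitian3 :
  sigma A = d * e + e * f + f * d - onormsq a - onormsq b - onormsq c.
Proof.
rewrite /sigma otrace_hermitian /otrace /mxtrace !big_ord_recl big_ord0.
rewrite !mxE !big_ord_recl !big_ord0 !mxE /= !addr0 !oReD !oRe_oreal2.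
by rewrite !oRe_conj_mul !oRe_mul_conj; field.
Qed.

Lemma char_op_eigen_coord r (v : 'cV[octonion R]_3) i :
  char_op d e f a b c v = r *:o v ->
  (A *mo (A *mo (A *mo v))) i 0 - (d + e + f) *: (A *mo (A *mo v)) i 0
  + sigma A *: (A *mo v) i 0 - freudenthal_det d e f a b c *: v i 0
  = r *: v i 0.
Proof.
rewrite /char_op otrace_hermitian.
exact: (@col_char_coord R (octonion R)).
Qed.

(** The eigenvalue, which simplifies to r + 2 Re(b(ac)), does not depend on [i] or [v]; hence all
    coordinates of [y] and [z] share it. *)
Lemma char_op_sandwich_eigen r (v : 'cV[octonion R]_3) i :
  char_op d e f a b c v = r *:o v ->
  @sandwich_eigen R (octonion_has_laws R) a b c
   (r - (d * e * f - d * onormsq c - e * onormsq b - f * onormsq a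
    - freudenthal_det d e f a b c)) (v i 0).
Proof.
move=> Kv.
have [X1 X2 X3] := hermitian3_mul v.
have [Y1 Y2 Y3] := hermitian3_mul (A *mo v).
have [Z1 Z2 Z3] := hermitian3_mul (A *mo (A *mo v)).
have [E1 E2 E3] := @char_op_sandwich R (octonion_has_laws R) d e f
  (freudenthal_det d e f a b c) r a b c _ _ _ _ _ _ _ _ _ _ _ _
  X1 X2 X3 Y1 Y2 Y3 Z1 Z2 Z3.
have K j := char_op_eigen_coord j Kv.
rewrite sigma_hermitian3 in K.
case: (unliftP ord0 i) => [j|] ->; last exact: E1 (K _).
case: (unliftP ord0 j) => [l|] ->; last exact: E2 (K _).
by rewrite [l]ord1; exact: E3 (K _).
Qed.
End CharacteristicOperator.

Lemma omul_sumr (R : realFieldType) (I : finType) p (F : I -> octonion R) :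
  p *o (\sum_i F i) = \sum_i p *o F i.
Proof. by apply: (big_morph (omul p) (@omulDr R p)); exact: omul0. Qed.

Theorem theorem2 (R : realType) (d e f : R) (a b c : octonion R)
    (halpha : (a *o b) *o c - a *o (b *o c) != 0)
    (r : R) (y z : 'cV[octonion R]_3)
    (hy : char_op d e f a b c y = r *:o y)
    (hz : char_op d e f a b c z = r *:o z) :
  (y *mo dagger y) *mo ((y *mo dagger y) *mo z)
  = vnormsq y *:o ((y *mo dagger y) *mo z).
Proof.
have yyE i j : (y *mo dagger y) i j = y i 0 *o oconj (y j 0).
  by rewrite mxE big_ord1 !mxE.
have yyzE i : ((y *mo dagger y) *mo z) i 0
    = \sum_k (y i 0 *o oconj (y k 0)) *o z k 0.
  by rewrite mxE; apply: eq_bigr => k _; rewrite yyE.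
have Y l := char_op_sandwich_eigen l hy.
have Z l := char_op_sandwich_eigen l hz.
apply/matrixP => i j0; rewrite (ord1 j0) [RHS]mxE yyzE mxE.
transitivity (\sum_j onormsq (y j 0) *:
    \sum_k (y i 0 *o oconj (y k 0)) *o z k 0); last first.
  exact/esym/scaler_suml.
apply: eq_bigr => j _; rewrite yyE yyzE.
transitivity (\sum_k (y i 0 *o oconj (y j 0)) *o
    ((y j 0 *o oconj (y k 0)) *o z k 0)); first exact: omul_sumr.
transitivity (\sum_k onormsq (y j 0) *: ((y i 0 *o oconj (y k 0)) *o z k 0));
  last exact/esym/scaler_sumr.
(* Both sides are now double sums over [j] and [k]; their terms agree by the eigenspace identity for
   y_i, y_j, y_k and z_k. *)
apply: eq_bigr => k _.
exact: (@sandwich_eigen_assoc R (octonion_has_laws R) a b c _ _ _ _ _ halpha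
  (Y i) (Y j) (Y k) (Z k)).
Qed.
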